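(* In $AdS_2=\mathrm{Ad}(SL_2(\mathbb{R}))H$, let the singularity $\mathscr{S}$ be the union of the closed orbits of $AN$ and $A\overline{N}$ for the adjoint action. For every point $x$ of the physical space, each of the two light lines through $x$ intersects both the part of the singularity passing through $H$ and the part of the singularity passing through $-H$, so that each light line meets the singularity both at a positive and at a negative value of its parameter (every point comes from the singularity and returns to the singularity). In particular every point of the physical space is interior, and no black hole arises: there is no event horizon in the physical space.
   Context: $H,E,F$ is the basis of $\mathfrak{sl}_2(\mathbb{R})$ with $[H,E]=2E$, $[H,F]=-2F$, $[E,F]=H$; $A=\exp(\mathbb{R}H)$, $N=\exp(\mathbb{R}E)$, $\overline{N}=\exp(\mathbb{R}F)$. Up to a double covering, $AdS_2$ is the adjoint orbit $\mathrm{Ad}(SL_2(\mathbb{R}))H=\{x_HH+x_EE+x_FF : x_H^2+x_Ex_F=1\}$. The singularity $\mathscr{S}$ consists of the four lines $\pm H+\lambda E$, $\pm H+\lambda F$ ($\lambda\in\mathbb{R}$); the part passing through $H$ is $\{H+\lambda E\}\cup\{H+\lambda F\}$ and the part passing through $-H$ is $\{-H+\lambda E\}\cup\{-H+\lambda F\}$. The physical space is the part of $AdS_2$ with $x_E>0$ and $x_F>0$. The two light lines through $x=\mathrm{Ad}(g)H$ are $s\mapsto\mathrm{Ad}(g)\mathrm{Ad}(e^{sE})H$ and $s\mapsto \mathrm{Ad}(g)\mathrm{Ad}(e^{-sF})H$, $s\in\mathbb{R}$; the future light cone consists of the half-lines $s>0$. A point is interior if every future light half-line from it meets $\mathscr{S}$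 at a finite parameter value, and the event horizon is the boundary of the set of interior points (here, inside the physical space). *)

(* Defs.v *)
From HB Require Import structures.
From mathcomp Require Import all_boot all_order all_algebra.
From mathcomp Require Import all_classical all_reals all_analysis.
Export numFieldNormedType.Exports.

Set Implicit Arguments.
Unset Strict Implicit.
Unset Printing Implicit Defensive.

Import Order.TTheory GRing.Theory Num.Theory.
Local Open Scope classical_set_scope.
Local Open Scope ring_scope.

Section AdS2.
Variable R : realType.

(* sl_2(R) is realised as the traceless matrices in 'M[R]_2, so that
   [X, Y] = X *m Y - Y *m X and Ad is conjugation. *)
Definition slH : 'M[R]_2 := delta_mx 0 0 - delta_mx 1 1.
Definition slE : 'M[R]_2 := delta_mx 0 1.
Definition slF : 'M[R]_2 := delta_mx 1 0.

Definition SL2 : set 'M[R]_2 := [set g | \det g = 1].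

Definition Ad (g X : 'M[R]_2) : 'M[R]_2 := g *m X *m invmx g.

Definition mexp (X : 'M[R]_2) : 'M[R]_2 :=
  limn (series (fun n => (n`!%:R : R)^-1 *: X ^+ n)).

Definition grpA : set 'M[R]_2 := range (fun t : R => mexp (t *: slH)).
Definition grpN : set 'M[R]_2 := range (fun t : R => mexp (t *: slE)).
Definition grpNbar : set 'M[R]_2 := range (fun t : R => mexp (t *: slF)).

Definition grpAN : set 'M[R]_2 := [set a *m n | a in grpA & n in grpN].
Definition grpANbar : set 'M[R]_2 := [set a *m n | a in grpA & n in grpNbar].

Definition Ad_orbit (G : set 'M[R]_2) (x : 'M[R]_2) : set 'M[R]_2 :=
  [set Ad g x | g in G].

Definition AdS2 : set 'M[R]_2 := Ad_orbit SL2 slH.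

(* [subspace AdS2] carries the topology induced on AdS2 by 'M[R]_2. *)
Definition closed_orbits (G : set 'M[R]_2) : set (set 'M[R]_2) :=
  [set O | (exists2 x, AdS2 x & O = Ad_orbit G x) /\
           closed (O : set (subspace AdS2))].

Definition singularity : set 'M[R]_2 :=
  \bigcup_(O in closed_orbits grpAN `|` closed_orbits grpANbar) O.

(* For P = slH or P = - slH: the part of the singularity lying on the two
   lines P + l E and P + l F, that is, the part passing through P. *)
Definition singularity_part (P : 'M[R]_2) : set 'M[R]_2 :=
  singularity `&`
    (range (fun l : R => P + l *: slE) `|` range (fun l : R => P + l *: slF)).

Definition physical : set 'M[R]_2 :=
  [set x | AdS2 x /\
     exists xH xE xF : R,
       [/\ x = xH *: slH + xE *: slE + xF *: slF, 0 < xE & 0 < xF]].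

(* The two light lines through Ad g slH are obtained for Z = slE and
   Z = - slF.  As g is only determined by Ad g slH up to the stabiliser of
   slH, the same light line has several parametrisations; the definitions
   and statements below quantify over all such g. *)
Definition light_directions : set 'M[R]_2 := [set slE; - slF].

Definition light_line (g Z : 'M[R]_2) (s : R) : 'M[R]_2 :=
  Ad g (Ad (mexp (s *: Z)) slH).

Definition interior_points : set 'M[R]_2 :=
  [set x | AdS2 x /\
     forall g Z, SL2 g -> x = Ad g slH -> light_directions Z ->
       exists2 s : R, 0 < s & singularity (light_line g Z s)].

(* Topological boundary in AdS2. *)
Definition event_horizon : set 'M[R]_2 :=
  closure (interior_points : set (subspace AdS2)) `\`
  interior (interior_points : set (subspace AdS2)).

End AdS2.

(* Main.v *)
Require Import Defs.
From HB Require Import structures.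
From mathcomp Require Import all_boot all_order all_algebra.
From mathcomp Require Import all_classical all_reals all_analysis.
From mathcomp Require Import ring lra.

(** Write a traceless matrix as x = xH H + xE E + xF F and let g have rows
    (a, b) and (c, d), with a d - b c = 1.  Conjugation by g is an explicit
    linear map of (xH, xE, xF) (Ad_sl2), and everything is read off from it.

    The orbits of AN and ANbar through H and -H are the four lines
    +-H + l E and +-H + l F (orbit_AN, orbit_ANbar): A fixes +-H and rescales
    E and F, while N and Nbar translate +-H along E and F.  Being affine lines
    they are closed, so these lines lie in the singularity.

    If x = Ad g H, then xE = - 2 a b and xF = 2 c d, so x is physical exactly
    when a b < 0 < c d.  The exponential of s E is 1 + s E, so
    Ad (e^(sE)) H = H - 2 s E and the light line in the direction E is affine
    in s, with
      xE(s) = - 2 a (b + s a)   and   xF(s) = 2 c (d + s c).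
    Here xE vanishes at s = - b / a > 0, where xH(s) = a d - b c = 1, so the
    light line meets the line of points H + l F.  And xF vanishes at
    s = - d / c < 0, where xH(s) = - (a d - b c) = - 1, so the light line meets
    the line of points - H + l E.
    The direction - F is treated in the same way, with parameters c / d > 0 and
    a / b < 0 (light_line_hits).

    Hence all physical points are interior.  The physical space is open in
    AdS2, being cut out there by the strict inequalities xE > 0 and xF > 0
    (physical_nbhs), so its points lie in the topological interior of the set
    of interior points, hence not on its boundary. *)

Import Order.TTheory GRing.Theory Num.Theory.
Local Open Scope classical_set_scope.
Local Open Scope ring_scope.

(** * Two by two matrices and the adjoint action *)

Lemma ord2_ind (P : 'I_2 -> Prop) : P 0 -> P 1 -> forall i, P i.
Proof.
move=> P0 P1 [[|[|//]] lti2].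
  by rewrite (_ : Ordinal lti2 = 0) //; apply: val_inj.
by rewrite (_ : Ordinal lti2 = 1) //; apply: val_inj.
Qed.

Section TwoByTwo.
Context {R : realType}.
Implicit Types (M g : 'M[R]_2).

Lemma mx2P M M' : M 0 0 = M' 0 0 -> M 0 1 = M' 0 1 ->
  M 1 0 = M' 1 0 -> M 1 1 = M' 1 1 -> M = M'.
Proof.
move=> e00 e01 e10 e11; apply/matrixP.
by apply: ord2_ind; apply: ord2_ind.
Qed.

Lemma mulmx2E M M' i j : (M *m M') i j = M i 0 * M' 0 j + M i 1 * M' 1 j.
Proof.
rewrite mxE 2!big_ord_recl big_ord0 addr0.
by congr (_ * _ + M i _ * M' _ j); apply: val_inj.
Qed.

Lemma det2E M : \det M = M 0 0 * M 1 1 - M 0 1 * M 1 0.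
Proof.
have l0 : lift 0 0 = 1 :> 'I_2 by apply: val_inj.
have l1 : lift 1 0 = 0 :> 'I_2 by apply: val_inj.
rewrite (expand_det_row M 0) 2!big_ord_recl big_ord0 l0.
rewrite /cofactor !det_mx11 !mxE l0 l1 /= addr0 expr0 expr1; ring.
Qed.

Definition sl2 (h e f : R) : 'M[R]_2 := h *: slH R + e *: slE R + f *: slF R.

Lemma sl2E h e f : (sl2 h e f 0 0 = h) * (sl2 h e f 0 1 = e) *
  (sl2 h e f 1 0 = f) * (sl2 h e f 1 1 = - h).
Proof.
by rewrite /sl2 /slH /slE /slF !mxE /= ?(mulr0n, mulr1n); do !split; ring.
Qed.

(** With Y the right-hand side, the claim is g X = Y g; entrywise, the two sides
    differ by a multiple of det g - 1. *)
Lemma Ad_sl2 g h e f : \det g = 1 ->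
  let a := g 0 0 in let b := g 0 1 in let c := g 1 0 in let d := g 1 1 in
  Ad g (sl2 h e f) = sl2 ((a * d + b * c) * h - a * c * e + b * d * f)
                         (- 2 * a * b * h + a ^+ 2 * e - b ^+ 2 * f)
                         (2 * c * d * h - c ^+ 2 * e + d ^+ 2 * f).
Proof.
move=> dg a b c d; set Y := (RHS).
have gu : g \in unitmx by rewrite unitmxE dg unitr1.
have {}dg : a * d = 1 + b * c.
  by rewrite -dg det2E subrK.
suff gXY : g *m sl2 h e f = Y *m g by rewrite /Ad gXY mulmxK.
have key : forall x y k : R, x - y = k * (a * d - 1 - b * c) -> x = y.
  by move=> x y k xy; apply/eqP; rewrite -subr_eq0 xy dg; apply/eqP; ring.
apply: mx2P; rewrite !mulmx2E !sl2E -/a -/b -/c -/d.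
- apply: (key _ _ (- (a * h + b * f))); ring.
- apply: (key _ _ (b * h - a * e)); ring.
- apply: (key _ _ (- (c * h + d * f))); ring.
- apply: (key _ _ (d * h - c * e)); ring.
Qed.

End TwoByTwo.

(** * Exponentials of H, E and F *)

Section Exponentials.
Context {R : realType}.
Implicit Types (t : R).

Lemma mexp_slH t :
  mexp (t *: slH R) = expR t *: delta_mx 0 0 + expR (- t) *: delta_mx 1 1.
Proof.
have pow n : (t *: slH R) ^+ n =
    t ^+ n *: delta_mx 0 0 + (- t) ^+ n *: delta_mx 1 1.
  elim: n => [|n IHn].
    by apply: mx2P; rewrite !mxE /= ?(mulr1n, mulr0n); ring.
  rewrite exprS IHn; apply: mx2P; rewrite mulmx2E !mxE /=;
    rewrite ?(mulr1n, mulr0n) !exprS; ring.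
apply: cvg_lim => //.
rewrite (_ : series _ = fun n => series (exp_coeff t) n *: delta_mx 0 0 +
    series (exp_coeff (- t)) n *: delta_mx 1 1); last first.
  apply/funext => n; rewrite /series /= !scaler_suml -big_split /=.
  by apply: eq_bigr => i _; rewrite pow scalerDr !scalerA ![_^-1 * _]mulrC.
by apply: cvgD; apply: cvgZr_tmp; exact: is_cvg_series_exp_coeff.
Qed.

(** All terms of degree at least two vanish, so the partial sums of the series
    are eventually constant. *)
Lemma mexp_nilp (X : 'M[R]_2) : X *m X = 0 -> mexp X = 1 + X.
Proof.
move=> XX.
have partial n : (1 < n)%N ->
    series (fun k => (k`!%:R : R)^-1 *: X ^+ k) n = 1 + X.
  case: n => [|[|n]] // _; rewrite /series /=.
  rewrite big_nat_recl // big_nat_recl // big1_seq => [|i _].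
    by rewrite expr0 expr1 !fact0 invr1 !scale1r addr0.
  by rewrite exprS exprS mulrA (_ : X * X = 0) // mul0r scaler0.
by apply: lim_near_cst => //; near=> n; apply: partial; near: n;
  exact: nbhs_infty_gt.
Unshelve. all: by end_near. Qed.

Lemma mexp_slH0 : mexp (0 *: slH R) = 1%:M.
Proof.
rewrite mexp_slH oppr0 expR0.
by apply: mx2P; rewrite !mxE /= ?(mulr1n, mulr0n); ring.
Qed.

Lemma mexp_slE t : mexp (t *: slE R) = 1 + t *: slE R.
Proof.
apply: mexp_nilp.
by apply: mx2P; rewrite mulmx2E !mxE /= ?(mulr1n, mulr0n); ring.
Qed.

Lemma mexp_slF t : mexp (t *: slF R) = 1 + t *: slF R.
Proof.
apply: mexp_nilp.
by apply: mx2P; rewrite mulmx2E !mxE /= ?(mulr1n, mulr0n); ring.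
Qed.

End Exponentials.

(** * The four lines of the singularity *)

Section Singularity.
Context {R : realType}.
Implicit Types (h e f l t u s : R) (g y : 'M[R]_2).

Lemma slH_sl2 : slH R = sl2 1 0 0.
Proof. by rewrite /sl2 scale1r !scale0r !addr0. Qed.

Lemma AdS2_sl2 h e f g :
  \det g = 1 -> Ad g (slH R) = sl2 h e f -> AdS2 (sl2 h e f).
Proof. by move=> dg <-; exists g. Qed.

Lemma AdS2_poles (h : R) : h = 1 \/ h = - 1 -> AdS2 (sl2 h 0 0).
Proof.
case=> ->.
  apply: (@AdS2_sl2 _ _ _ 1); rewrite ?det1 // slH_sl2 Ad_sl2 ?det1 //.
  by rewrite !mxE /=; congr sl2; ring.
(* The Weyl element E - F exchanges H and - H. *)
have dw : \det (slE R - slF R) = 1 by rewrite det2E !mxE /=; ring.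
apply: (AdS2_sl2 _ _ _ _ dw).
by rewrite slH_sl2 Ad_sl2 // !mxE /=; congr sl2; ring.
Qed.

Lemma closed_coord (c : 'M[R]_2 -> R) (v : R) : continuous c ->
  closed ([set x | c x = v] : set (subspace (@AdS2 R))).
Proof.
move=> cc; apply: (@preimage_closed _ _ (c : subspace (@AdS2 R) -> R) [set v]).
  by move=> x _; exact: (continuous_subspaceT cc).
exact: closed_eq.
Qed.

Lemma Ad_AN t u h :
  Ad (mexp (t *: slH R) *m mexp (u *: slE R)) (sl2 h 0 0) =
  sl2 h (- 2 * u * expR t ^+ 2 * h) 0.
Proof.
have tt : expR t * expR (- t) = 1 by rewrite -expRD subrr expR0.
set g := _ *m _.
have [ga gb gc gd] : [/\ g 0 0 = expR t, g 0 1 = u * expR t, g 1 0 = 0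
    & g 1 1 = expR (- t)].
  rewrite /g mexp_slH mexp_slE; split;
    rewrite mulmx2E !mxE /= ?(mulr1n, mulr0n); ring.
rewrite Ad_sl2 ?det2E ga gb gc gd tt; first by congr sl2; ring.
by ring.
Qed.

Lemma Ad_ANbar t u h :
  Ad (mexp (t *: slH R) *m mexp (u *: slF R)) (sl2 h 0 0) =
  sl2 h 0 (2 * u * expR (- t) ^+ 2 * h).
Proof.
have tt : expR t * expR (- t) = 1 by rewrite -expRD subrr expR0.
set g := _ *m _.
have [ga gb gc gd] : [/\ g 0 0 = expR t, g 0 1 = 0, g 1 0 = u * expR (- t)
    & g 1 1 = expR (- t)].
  rewrite /g mexp_slH mexp_slF; split;
    rewrite mulmx2E !mxE /= ?(mulr1n, mulr0n); ring.
rewrite Ad_sl2 ?det2E ga gb gc gd tt; first by congr sl2; ring.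
by ring.
Qed.

(** The factor A does not enlarge the N-orbit, because it fixes H and rescales
    E; so every point of the line is reached with t = 0. *)
Lemma orbit_AN h : h != 0 ->
  Ad_orbit (@grpAN R) (sl2 h 0 0) = range (fun l => sl2 h l 0).
Proof.
move=> h0; apply/seteqP; split => y /=.
  by case=> _ [_ [t _ <-]] [_ [u _ <-]] <- <-; rewrite Ad_AN; eexists.
case=> l _ <-; exists (mexp (0 *: slH R) *m mexp ((- l / (2 * h)) *: slE R)).
  by exists (mexp (0 *: slH R)); [exists 0|eexists; first by eexists].
by rewrite Ad_AN expR0; congr sl2; field.
Qed.

Lemma orbit_ANbar h : h != 0 ->
  Ad_orbit (@grpANbar R) (sl2 h 0 0) = range (fun l => sl2 h 0 l).
Proof.
move=> h0; apply/seteqP; split => y /=.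
  by case=> _ [_ [t _ <-]] [_ [u _ <-]] <- <-; rewrite Ad_ANbar; eexists.
case=> l _ <-; exists (mexp (0 *: slH R) *m mexp ((l / (2 * h)) *: slF R)).
  by exists (mexp (0 *: slH R)); [exists 0|eexists; first by eexists].
by rewrite Ad_ANbar oppr0 expR0; congr sl2; field.
Qed.

(** The line is the AN-orbit of h H, and it is closed because it is cut out by
    equations on coordinates. *)
Lemma singularity_lineE h l : h = 1 \/ h = - 1 -> singularity (sl2 h l 0).
Proof.
move=> h1; have h0 : h != 0.
  by case: h1 => ->; rewrite ?oppr_eq0 oner_eq0.
exists (range (fun l => sl2 h l 0)); last by exists l.
left; split.
  by exists (sl2 h 0 0); [exact: AdS2_poles|rewrite orbit_AN].
have -> : range (fun l => sl2 h l 0) = [set y : 'M[R]_2 | y 0 0 = h] `&`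
    [set y | y 1 0 = 0] `&` [set y | y 1 1 = - h].
  apply/seteqP; split => y /=; first by case=> k _ <-; rewrite !sl2E.
  by case=> -[y00 y01] y11; exists (y 0 1) => //; apply: mx2P; rewrite !sl2E.
apply: closedI; first apply: closedI.
all: by apply: closed_coord; exact: coord_continuous.
Qed.

Lemma singularity_lineF h l : h = 1 \/ h = - 1 -> singularity (sl2 h 0 l).
Proof.
move=> h1; have h0 : h != 0.
  by case: h1 => ->; rewrite ?oppr_eq0 oner_eq0.
exists (range (fun l => sl2 h 0 l)); last by exists l.
right; split.
  by exists (sl2 h 0 0); [exact: AdS2_poles|rewrite orbit_ANbar].
have -> : range (fun l => sl2 h 0 l) = [set y : 'M[R]_2 | y 0 0 = h] `&`
    [set y | y 0 1 = 0] `&` [set y | y 1 1 = - h].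
  apply/seteqP; split => y /=; first by case=> k _ <-; rewrite !sl2E.
  by case=> -[y00 y01] y11; exists (y 1 0) => //; apply: mx2P; rewrite !sl2E.
apply: closedI; first apply: closedI.
all: by apply: closed_coord; exact: coord_continuous.
Qed.

Lemma singularity_partE h l : h = 1 \/ h = - 1 ->
  singularity_part (h *: slH R) (sl2 h l 0).
Proof.
move=> h1; split; first exact: singularity_lineE.
by left; exists l; rewrite // /sl2 scale0r addr0.
Qed.

Lemma singularity_partF h l : h = 1 \/ h = - 1 ->
  singularity_part (h *: slH R) (sl2 h 0 l).
Proof.
move=> h1; split; first exact: singularity_lineF.
by right; exists l; rewrite // /sl2 scale0r addr0.
Qed.

End Singularity.

(** * Light lines from physical points *)

Section LightLines.
Context {R : realType}.
Implicit Types (s : R) (g x Z : 'M[R]_2).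

(** The computation for AN, specialised to the identity of A, gives
    Ad (e^(sE)) H = H - 2 s E. *)
Lemma light_lineE g s : \det g = 1 ->
  light_line g (slE R) s =
  sl2 (g 0 0 * g 1 1 + g 0 1 * g 1 0 + 2 * s * g 0 0 * g 1 0)
      (- 2 * g 0 0 * (g 0 1 + s * g 0 0))
      (2 * g 1 0 * (g 1 1 + s * g 1 0)).
Proof.
move=> dg; rewrite /light_line slH_sl2.
rewrite -[mexp (s *: slE R)]mul1mx -mexp_slH0.
by rewrite Ad_AN expR0 Ad_sl2 //; congr sl2; ring.
Qed.

Lemma light_lineNF g s : \det g = 1 ->
  light_line g (- slF R) s =
  sl2 (g 0 0 * g 1 1 + g 0 1 * g 1 0 - 2 * s * g 0 1 * g 1 1)
      (- 2 * g 0 1 * (g 0 0 - s * g 0 1))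
      (2 * g 1 1 * (g 1 0 - s * g 1 1)).
Proof.
move=> dg; rewrite /light_line slH_sl2.
rewrite scalerN -scaleNr -[mexp (- s *: slF R)]mul1mx -mexp_slH0.
by rewrite Ad_ANbar oppr0 expR0 Ad_sl2 //; congr sl2; ring.
Qed.

Lemma physical_signs g : SL2 g -> physical (Ad g (slH R)) ->
  g 0 0 * g 0 1 < 0 /\ 0 < g 1 0 * g 1 1.
Proof.
move=> dg [_ [h [e [f [xE e0 f0]]]]].
have : sl2 h e f = Ad g (slH R) by rewrite xE.
rewrite slH_sl2 Ad_sl2 // => E.
have := congr1 (fun y : 'M[R]_2 => y 0 1) E.
have := congr1 (fun y : 'M[R]_2 => y 1 0) E.
rewrite /= !sl2E => Ef Ee; split; nra.
Qed.

Lemma divr_gt0_mul (u v : R) : 0 < u * v -> 0 < u / v.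
Proof.
move=> uv; have v0 : v != 0.
  by apply: contraTneq uv => ->; rewrite mulr0 ltxx.
rewrite (_ : u / v = u * v * v^-1 ^+ 2); last by field.
by rewrite mulr_gt0 // exprn_even_gt0 //= invr_eq0.
Qed.

(** In each direction the line leaves the open set where xE and xF are positive
    at two parameters, one on each side of 0.  Where one of these two
    coordinates vanishes, xH is a square root of 1; the sign of xH is given by
    a d - b c = 1. *)
Lemma light_line_hits g Z : SL2 g -> physical (Ad g (slH R)) ->
  light_directions Z ->
  (exists2 s, 0 < s & singularity_part (slH R) (light_line g Z s)) /\
  (exists2 s, s < 0 & singularity_part (- slH R) (light_line g Z s)).
Proof.
move=> dg px DZ; have [ab cd] := physical_signs _ dg px.
have := ltr0_neq0 ab; rewrite mulf_eq0 negb_or => /andP[a0 b0].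
have := lt0r_neq0 cd; rewrite mulf_eq0 negb_or => /andP[c0 d0].
have Dg : g 0 0 * g 1 1 = 1 + g 0 1 * g 1 0 by rewrite -dg det2E subrK.
rewrite -scaleN1r -[in singularity_part (slH R)](scale1r (slH R)).
case: DZ => ->; split.
- exists (- g 0 1 / g 0 0); first by apply: divr_gt0_mul; lra.
  rewrite light_lineE //; set h := (X in sl2 X); set e := (X in sl2 _ X).
  have -> : h = 1 by rewrite /h Dg; field.
  have -> : e = 0 by rewrite /e; field.
  by apply: singularity_partF; left.
- exists (- (g 1 1 / g 1 0)).
    by rewrite oppr_lt0; apply: divr_gt0_mul; rewrite mulrC.
  rewrite light_lineE //; set h := (X in sl2 X); set f := (X in sl2 _ _ X).
  have -> : h = - 1.
    rewrite /h (_ : _ + _ = - (g 0 0 * g 1 1) + g 0 1 * g 1 0); last by field.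
    by rewrite Dg; ring.
  have -> : f = 0 by rewrite /f; field.
  by apply: singularity_partE; right.
- exists (g 1 0 / g 1 1); first exact: divr_gt0_mul.
  rewrite light_lineNF //; set h := (X in sl2 X); set f := (X in sl2 _ _ X).
  have -> : h = 1 by rewrite /h Dg; field.
  have -> : f = 0 by rewrite /f; field.
  by apply: singularity_partE; left.
- exists (- (- g 0 0 / g 0 1)).
    by rewrite oppr_lt0; apply: divr_gt0_mul; lra.
  rewrite light_lineNF //; set h := (X in sl2 X); set e := (X in sl2 _ X).
  have -> : h = - 1.
    rewrite /h (_ : _ - _ = - (g 0 0 * g 1 1) + g 0 1 * g 1 0); last by field.
    by rewrite Dg; ring.
  have -> : e = 0 by rewrite /e; field.
  by apply: singularity_partF; right.
Qed.

Lemma physical_interior_points : @physical R `<=` @interior_points R.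
Proof.
move=> x px; split; first by case: px.
move=> g Z dg xE DZ; rewrite xE in px.
by have [[s s0 [ss _]] _] := light_line_hits _ _ dg px DZ; exists s.
Qed.

Lemma AdS2_eta x : AdS2 x -> x = sl2 (x 0 0) (x 0 1) (x 1 0).
Proof. by case=> g dg <-; rewrite slH_sl2 Ad_sl2 // !sl2E. Qed.

Lemma physicalE x : AdS2 x -> physical x <-> 0 < x 0 1 /\ 0 < x 1 0.
Proof.
move=> xA; split; first by case=> _ [h [e [f [-> e0 f0]]]]; rewrite !sl2E.
case=> e0 f0; split=> //; exists (x 0 0), (x 0 1), (x 1 0).
by split=> //; exact: AdS2_eta.
Qed.

Lemma physical_nbhs (x : 'M[R]_2) : physical x ->
  nbhs (x : subspace (@AdS2 R)) (@physical R).
Proof.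
move=> px; have xA : AdS2 x by case: px.
have [e0 f0] := (physicalE x xA).1 px.
have pos i j : 0 < x i j -> \forall y \near x, 0 < (y : 'M[R]_2) i j.
  by move=> xij; exact: (cvgr_gt _ (@coord_continuous R 2 2 i j x)).
apply/(nbhs_subspace_ex _ xA).
exists [set y : 'M[R]_2 | 0 < y 0 1 /\ 0 < y 1 0].
  by apply: filterI; exact: pos.
apply/seteqP; split => y /= [py yA]; split=> //; exact/(physicalE y yA).
Qed.

End LightLines.

Theorem mainTheorem3 (R : realType) :
  [/\ (forall x g Z : 'M[R]_2,
         physical x -> SL2 g -> x = Ad g (slH R) -> light_directions Z ->
         [/\ exists s : R, singularity_part (slH R) (light_line g Z s),
             exists s : R, singularity_part (- slH R) (light_line g Z s),
             exists2 s : R, 0 < s & singularity (light_line g Z s)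
           & exists2 s : R, s < 0 & singularity (light_line g Z s)]),
      physical (R := R) `<=` interior_points (R := R)
    & event_horizon (R := R) `&` physical (R := R) = set0].
Proof.
split; last 2 first.
- exact: physical_interior_points.
- rewrite -subset0 => x [[_ nix] px]; apply: nix.
  by apply: filterS (physical_nbhs x px); exact: physical_interior_points.
move=> x g Z + dg xE DZ; rewrite xE => px.
have [[s s0 sH] [t t0 tH]] := light_line_hits _ _ dg px DZ.
by split; [exists s|exists t|exists s => //; case: sH|exists t => //; case: tH].
Qed.
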